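(* Let $S$ be a finite nonempty set of states, $C=\{0,1,\dots,K\}$ ($K\ge 1$) a finite set of consequences, and let $\succsim$ be a binary relation on the set of all lotteries on $S\times C$. Then $\succsim$ satisfies axioms A1--A5 if and only if it is represented by a nonempty closed convex set $\mathcal{V}^*\subseteq\mathcal{V}^+$ of state-dependent expected utility functions, i.e. there is a nonempty closed convex $\mathcal{V}^*\subseteq\mathcal{V}^+$ with $$\mathbf{X}\succsim\mathbf{Y}\iff U_v(\mathbf{X})-U_v(\mathbf{Y})\ge 0\ \text{ for all } v\in\mathcal{V}^*$$ for all lotteries $\mathbf{X},\mathbf{Y}$. In particular, if $\succsim$ satisfies A1--A5 and $\{\mathbf{X}_n\succsim\mathbf{Y}_n\}$ is a basis for $\succsim$ under A1--A5, then $\mathcal{V}^*$ is the set of all $v\in\mathcal{V}^+$ satisfying $U_v(\mathbf{X}_n)\ge U_v(\mathbf{Y}_n)$ for all $n$.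
   Context: A (horse) lottery is a function $\mathbf{X}:S\times C\to\mathbb{R}$ with $X(s,c)\ge 0$ for all $s,c$ and $\sum_{c}X(s,c)=1$ for every $s\in S$. For $c\in C$, $\mathbf{H}_c$ is the lottery with $\mathbf{H}_c(s,c')=1$ if $c'=c$ and $0$ otherwise (for every $s$). Consequences $0$ and $1$ play the roles of worst and best. $\mathbf{X}\succ\mathbf{Y}$ means $\mathbf{X}\succsim\mathbf{Y}$ and not $\mathbf{Y}\succsim\mathbf{X}$. Axioms (on a relation $\succsim$ on lotteries): - A1 (quasi order): $\succsim$ is transitive and reflexive. - A2 (mixture-independence): for all lotteries $\mathbf{X},\mathbf{Y},\mathbf{Z}$ and all $\alpha\in(0,1)$: $\mathbf{X}\succsim\mathbf{Y}\iff\alpha\mathbf{X}+(1-\alpha)\mathbf{Z}\succsim\alpha\mathbf{Y}+(1-\alpha)\mathbf{Z}$. - A3 (continuity): if $\{\mathbf{X}_n\}$, $\{\mathbf{Y}_n\}$ are convergent sequences of lotteries with $\mathbf{X}_n\succsim\mathbf{Y}_n$ for all $n$, then $\lim\mathbf{X}_n\succsim\lim\mathbf{Y}_n$. - A4 (best and worst): for all $c>1$, $\mathbf{H}_1\succsim\mathbf{H}_c\succsim\mathbf{H}_0$. - A5 (coherence/nontriviality): $\mathbf{H}_1\succ\mathbf{H}_0$, i.e. $\mathbf{H}_1\succsim\mathbf{H}_0$ and not $\mathbf{H}_0\succsim\mathbf{H}_1$. A collection of preferences $\{\mathbf{X}_n\succsim\mathbf{Y}_n\}$ (a subset, possibly infinite,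 of the relation $\succsim$) is a basis for $\succsim$ under an axiom system if every preference $\mathbf{X}\succsim\mathbf{Y}$ can be deduced from $\{\mathbf{X}_n\succsim\mathbf{Y}_n\}$ by direct application of those axioms; that is, $\succsim$ is the smallest relation containing the collection and satisfying the axioms. A state-dependent expected utility (s.d.e.u.) function is a function $v:S\times C\to\mathbb{R}$; it induces $U_v(\mathbf{X})=\sum_{s\in S,c\in C}X(s,c)v(s,c)$. The normalized set is $$\mathcal{V}^+=\Big\{v:\ v(s,0)=0\ \forall s;\ \ 0\le\sum_{s\in S}v(s,c)\le 1\ \forall c\ge 2;\ \ \sum_{s\in S}v(s,1)=1\Big\}.$$ *)

(* Defs.v *)
From mathcomp Require Import all_boot all_order all_algebra.
From mathcomp Require Import all_classical all_reals all_analysis.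

Set Implicit Arguments.
Unset Strict Implicit.
Unset Printing Implicit Defensive.

Import Order.TTheory GRing.Theory Num.Theory.
Import numFieldNormedType.Exports.

Local Open Scope classical_set_scope.
Local Open Scope ring_scope.

(* The consequences {0, ..., K} are 'I_K.+1; [best] is the consequence 1
   provided that 0 < K. *)
Definition worst {K : nat} : 'I_K.+1 := ord0.
Definition best {K : nat} : 'I_K.+1 := inord 1.

Section Lotteries.
Variables (R : realType) (S : finType) (K : nat).

Record lottery := Lottery {
  lottery_fun :> S * 'I_K.+1 -> R;
  lottery_ge0 : forall s c, 0 <= lottery_fun (s, c);
  lottery_sum1 : forall s, \sum_(c < K.+1) lottery_fun (s, c) = 1 }.

Definition mix_fun (a : R) (X Z : lottery) (p : S * 'I_K.+1) : R :=
  a * X p + (1 - a) * Z p.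

Lemma mix_ge0 (a : R) (a01 : 0 < a < 1) (X Z : lottery) s c :
  0 <= mix_fun a X Z (s, c).
Proof.
case/andP: a01 => a0 a1.
by rewrite addr_ge0// mulr_ge0 ?lottery_ge0 ?subr_ge0// ltW.
Qed.

Lemma mix_sum1 (a : R) (X Z : lottery) s :
  \sum_(c < K.+1) mix_fun a X Z (s, c) = 1.
Proof.
by rewrite big_split/= -!mulr_sumr !lottery_sum1 !mulr1 addrC subrK.
Qed.

Definition mix (a : R) (a01 : 0 < a < 1) (X Z : lottery) : lottery :=
  Lottery (mix_ge0 a01 X Z) (mix_sum1 a X Z).

Definition sure_fun (c : 'I_K.+1) (p : S * 'I_K.+1) : R := (p.2 == c)%:R.

Lemma sure_ge0 c s c' : 0 <= sure_fun c (s, c').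
Proof. exact: ler0n. Qed.

Lemma sure_sum1 c s : \sum_(c' < K.+1) sure_fun c (s, c') = 1.
Proof.
rewrite (bigD1 c)//= /sure_fun/= eqxx big1 ?addr0// => i /negbTE ->.
by [].
Qed.

(* The lottery H_c. *)
Definition sure (c : 'I_K.+1) : lottery := Lottery (sure_ge0 c) (sure_sum1 c).

Section Preferences.
Variable pref : lottery -> lottery -> Prop.

Definition strict_pref (X Y : lottery) : Prop := pref X Y /\ ~ pref Y X.

Definition quasi_order : Prop :=
  (forall X Y Z, pref X Y -> pref Y Z -> pref X Z) /\ (forall X, pref X X).

Definition mixture_independence : Prop :=
  forall (X Y Z : lottery) (a : R) (a01 : 0 < a < 1),
    pref X Y <-> pref (mix a01 X Z) (mix a01 Y Z).

(* As S * 'I_K.+1 is finite, pointwise convergence is the convergence of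
   R^(S * C), and a limit of lotteries is itself a lottery. *)
Definition continuity : Prop :=
  forall (X_ Y_ : nat -> lottery) (X Y : lottery),
    {ptws, (fun n => X_ n : S * 'I_K.+1 -> R) @ \oo --> (X : _ -> _)} ->
    {ptws, (fun n => Y_ n : S * 'I_K.+1 -> R) @ \oo --> (Y : _ -> _)} ->
    (forall n, pref (X_ n) (Y_ n)) -> pref X Y.

Definition best_and_worst : Prop :=
  forall c : 'I_K.+1, (1 < c)%N ->
    pref (sure best) (sure c) /\ pref (sure c) (sure worst).

Definition coherence : Prop := strict_pref (sure best) (sure worst).

Definition axiomsA1_A5 : Prop :=
  [/\ quasi_order, mixture_independence, continuity, best_and_worst
    & coherence].

End Preferences.

(* The collection of preferences X_ i >= Y_ i (I arbitrary) is a basis of pref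
   under the axioms: pref is the smallest relation that contains the collection
   and satisfies the axioms. *)
Definition is_basis (pref : lottery -> lottery -> Prop)
    (I : Type) (X_ Y_ : I -> lottery) : Prop :=
  [/\ axiomsA1_A5 pref,
      (forall i, pref (X_ i) (Y_ i))
    & forall pref' : lottery -> lottery -> Prop,
        axiomsA1_A5 pref' -> (forall i, pref' (X_ i) (Y_ i)) ->
        forall X Y, pref X Y -> pref' X Y].

Definition exputil (v : S * 'I_K.+1 -> R) (X : lottery) : R :=
  \sum_(s : S) \sum_(c < K.+1) X (s, c) * v (s, c).

Definition Vplus : set (S * 'I_K.+1 -> R) :=
  [set v | [/\ forall s, v (s, worst) = 0,
               forall c : 'I_K.+1, (2 <= c)%N ->
                 0 <= \sum_(s : S) v (s, c) <= 1
             & \sum_(s : S) v (s, best) = 1]].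

(* V represents pref. Utility functions carry the topology of pointwise
   convergence, i.e. that of the Euclidean space R^(S * C). *)
Definition closed_convex_rep (pref : lottery -> lottery -> Prop)
    (V : set (S * 'I_K.+1 -> R)) : Prop :=
  [/\ V !=set0,
      closed (V : set {ptws (S * 'I_K.+1) -> R}),
      convex_set V,
      V `<=` Vplus
    & forall X Y, pref X Y <->
        forall v, V v -> 0 <= exputil v X - exputil v Y].

End Lotteries.

(* Main.v *)
(* By mixture independence a preference X >= Y depends only on the direction of
   X - Y, and with A3 these directions form a closed convex cone. Separating a
   direction from the cone yields a utility function violating a given
   non-preference; adding a small multiple of one that separates H_1 from H_0
   makes it normalizable, so the dual of the cone within V+ represents pref.
   Conversely, a closed convex representing set within V+ must be that whole
   dual: a further utility function could be separated from it by a direction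
   that is a difference of two lotteries. *)
Require Import Defs.
From mathcomp Require Import all_boot all_order all_algebra.
From mathcomp Require Import all_classical all_reals all_analysis.
From mathcomp Require Import ring lra.

Import Order.TTheory GRing.Theory Num.Theory.
Import numFieldNormedType.Exports.

Local Open Scope classical_set_scope.
Local Open Scope ring_scope.

(** * Pointwise convergence, closedness and convexity in a function space *)

Lemma ptws_cvgP (R : realType) (T : Type) (F : set_system (T -> R)) (f : T -> R) :
  Filter F -> {ptws, F --> f} <-> forall t, g t @[g --> F] --> f t.
Proof.
move=> FF; rewrite cvg_sup; split => h t; move: (h t).
  rewrite cvg_image; last by rewrite eqEsubset; split=> v // _; exists (cst v).
  by apply: cvg_trans => W /=; rewrite ?nbhs_simpl /fmap /= => -[W' + <-];
    apply: filterS => g W'g /=; exists g.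
rewrite cvg_image; last by rewrite eqEsubset; split=> v // _; exists (cst v).
move=> + W //=; rewrite ?nbhs_simpl => Q => /Q Q'; exists (@^~ t @^-1` W) => //.
by rewrite eqEsubset; split => [j [? + <-//]|j Wj]; exists (fun _ => j).
Qed.

(** Closedness is phrased with sequences because A3 is, so that it applies directly to the cone of
    preference directions. *)
Definition pw_seq_closed {T : Type} {R : realType} (A : set (T -> R)) : Prop :=
  forall (u : nat -> T -> R) (l : T -> R), (forall n, A (u n)) ->
    (forall t, u n t @[n --> \oo] --> l t) -> A l.

Definition mix_closed {T : Type} {R : realType} (A : set (T -> R)) : Prop :=
  forall (a b : T -> R) (r : R), A a -> A b -> 0 < r < 1 ->
    A (fun t => r * a t + (1 - r) * b t).

Definition dot {T : finType} {R : realType} (z v : T -> R) : R :=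
  \sum_t z t * v t.

Lemma cvg_sumr (R : realType) (I U : Type) (F : set_system U) (r : seq I)
    (P : pred I) (f : I -> U -> R) (l : I -> R) :
  Filter F -> (forall i, P i -> f i x @[x --> F] --> l i) ->
  \sum_(i <- r | P i) f i x @[x --> F] --> \sum_(i <- r | P i) l i.
Proof.
move=> FF; apply: cvg_big => -[x y]; apply: (@cvgD _ _ _ _ _ fst snd) => //.
  exact: cvg_fst.
exact: cvg_snd.
Qed.

(** * Separation of a point from a closed convex set, then from a closed cone *)

Section Separation.
Variables (R : realType) (T : finType).
Implicit Types (A : set (T -> R)) (a b p q z : T -> R).

Let dist2 p a : R := \sum_t (a t - p t) ^+ 2.

Let dist2_ge0 p a : 0 <= dist2 p a.
Proof. by apply: sumr_ge0 => t _; rewrite sqr_ge0. Qed.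

(** A minimizing sequence is Cauchy in every coordinate by the parallelogram identity, since
    midpoints stay in [A]. Its limit attains the infimum. *)
Lemma nearest_point A p : A !=set0 -> mix_closed A -> pw_seq_closed A ->
  exists2 q, A q & forall a, A a -> dist2 p q <= dist2 p a.
Proof.
move=> [a0 Aa0] Amix Aclosed.
pose E := [set dist2 p a | a in A]; pose d := inf E.
have lbE : has_lbound E by exists 0 => _ [a _ <-].
have infE : has_inf E by split; [exists (dist2 p a0), a0|].
have dle a : A a -> d <= dist2 p a by move=> Aa; apply: ge_inf => //; exists a.
have /choice[u uP] n : exists a, A a /\ dist2 p a < d + n.+1%:R^-1.
  have [|_ [a Aa <-] lta] := inf_adherent _ infE (eps := n.+1%:R^-1).
    by rewrite invr_gt0.
  by exists a.
have close n m : \sum_t (u n t - u m t) ^+ 2 <= 2 * (n.+1%:R^-1 + m.+1%:R^-1).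
  have [[An ltn] [Am ltm]] := (uP n, uP m).
  have half : 0 < (2^-1 : R) < 1 by apply/andP; split; lra.
  have := dle _ (Amix _ _ _ An Am half).
  (* Parallelogram identity around [p]; the midpoint term is at least [4 * d]. *)
  have -> : \sum_t (u n t - u m t) ^+ 2 = 2 * dist2 p (u n) + 2 * dist2 p (u m)
      - 4 * dist2 p (fun t => 2^-1 * u n t + (1 - 2^-1) * u m t).
    rewrite /dist2 !mulr_sumr -big_split/= -sumrB; apply: eq_bigr => t _; field; lra.
  move: ltn ltm; move: (dist2 p (u n)) (dist2 p (u m)) (dist2 p _) => x y w.
  move: (n.+1%:R^-1) (m.+1%:R^-1) => xn xm; lra.
have cauchy_u t : cvg (u n t @[n --> \oo]).
  apply/cauchy_cvgP/cauchy_exP => e e0.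
  have e4 : 0 < e ^+ 2 / 4 by rewrite divr_gt0 ?exprn_gt0.
  have [N _ NP] := near_infty_natSinv_lt (PosNum e4).
  exists (u N t); exists N => // k /= Nk; rewrite -ball_normE/=.
  rewrite -(@ltr_pXn2r _ 2) ?nnegrE//; last exact: ltW.
  rewrite real_normK ?num_real//.
  apply: (@le_lt_trans _ _ (2 * (N.+1%:R^-1 + k.+1%:R^-1))).
    apply: le_trans (close N k). rewrite (bigD1 t)//= lerDl.
    by apply: sumr_ge0 => i _; rewrite sqr_ge0.
  have lt4 i : (N <= i)%N -> i.+1%:R^-1 < e ^+ 2 / 4 by exact: NP.
  move: (lt4 N (leqnn N)) (lt4 k Nk); move: (N.+1%:R^-1) (k.+1%:R^-1) => x y.
  lra.
pose q t := lim (u n t @[n --> \oo]).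
exists q; first by apply: (Aclosed u) => [n|t]; [exact: (uP n).1|exact: cauchy_u].
move=> a /dle; apply: le_trans.
have cq : dist2 p (u n) - n.+1%:R^-1 @[n --> \oo] --> dist2 p q - 0.
  apply: cvgB; last exact: cvg_harmonic.
  apply: cvg_sumr => t _; have cB : u n t - p t @[n --> \oo] --> q t - p t.
    by apply: cvgB; [exact: cauchy_u|exact: cvg_cst].
  by rewrite expr2; under eq_cvg do rewrite expr2; exact: cvgM.
rewrite -[leLHS]subr0; apply: cvgr_to_le cq _.
by apply: nearW => n; have [_] := uP n; rewrite lerBlDr => /ltW.
Qed.

(** The normal vector runs from [p] to its nearest point [q]. If some [a] in [A] lay on the wrong
    side of the hyperplane through [q], a short move from [q] towards [a] would come closer to
    [p]. *)
Lemma separate_point A p : A !=set0 -> mix_closed A -> pw_seq_closed A ->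
  ~ A p -> exists z (b : R), dot z p < b /\ forall a, A a -> b <= dot z a.
Proof.
move=> A0 Amix Aclosed NAp; have [q Aq qmin] := nearest_point A p A0 Amix Aclosed.
pose z t := q t - p t; exists z, (dot z q).
have dzq : dot z q = dot z p + dist2 p q.
  by rewrite /dot /dist2 -big_split; apply: eq_bigr => t _; rewrite /z/=; ring.
split=> [|a Aa].
  rewrite dzq ltrDl lt_neqAle dist2_ge0 andbT eq_sym; apply: contra_notN NAp.
  rewrite psumr_eq0 => [/allP pq|t _]; last by rewrite sqr_ge0.
  suff -> : p = q by [].
  apply/funext => t; move: (pq t); rewrite mem_index_enum sqrf_eq0 subr_eq0.
  by move=> /(_ isT) /eqP.
rewrite leNgt; apply/negP => lta.
pose c := dot z q - dot z a; pose N := dist2 q a.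
have c0 : 0 < c by rewrite subr_gt0.
have N0 : 0 <= N by exact: dist2_ge0.
have Nc : 0 < N + c + 1 by rewrite ltr_wpDl// addr_ge0// ltW.
(* This step size keeps [r < 1] and [r * N <= c], so the linear gain [2 * r * c] exceeds the
   quadratic loss [r ^+ 2 * N]. *)
pose r := c / (N + c + 1).
have r0 : 0 < r by rewrite divr_gt0.
have r1 : r < 1 by rewrite ltr_pdivrMr// mul1r; lra.
have rN : r * N <= c.
  by rewrite /r mulrAC ler_pdivrMr// ler_wpM2l ?ltW//; lra.
have := qmin _ (Amix _ _ r Aa Aq _); rewrite r0 r1 => /(_ isT).
have -> : dist2 p (fun t => r * a t + (1 - r) * q t) =
    dist2 p q - 2 * r * c + r ^+ 2 * N.
  rewrite /c /N /dot /dist2 -sumrB !mulr_sumr -sumrB -big_split/=.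
  by apply: eq_bigr => t _; rewrite /z; ring.
suff : r * (2 * c - r * N) > 0 by lra.
by rewrite mulr_gt0// subr_gt0; lra.
Qed.
End Separation.

Lemma dotZl (R : realType) (T : finType) (z v : T -> R) (k : R) :
  dot (fun t => k * z t) v = k * dot z v.
Proof. by rewrite /dot mulr_sumr; apply: eq_bigr => t _; rewrite mulrA. Qed.

Lemma dotZr (R : realType) (T : finType) (z v : T -> R) (k : R) :
  dot z (fun t => k * v t) = k * dot z v.
Proof. by rewrite /dot mulr_sumr; apply: eq_bigr => t _; rewrite mulrCA. Qed.

(** The separating bound is at most 0 because 0 lies in [D]. A negative value on [D] could be scaled
    below that bound, so the functional is nonnegative on [D]. *)
Lemma separate_cone (R : realType) (T : finType) (D : set (T -> R)) (p : T -> R) :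
  D (fun _ => 0) ->
  (forall a b, D a -> D b -> D (fun t => a t + b t)) ->
  (forall k a, 0 < k -> D a -> D (fun t => k * a t)) ->
  pw_seq_closed D -> ~ D p ->
  exists2 z, dot z p < 0 & forall a, D a -> 0 <= dot z a.
Proof.
move=> D0 DD DZ Dclosed NDp.
have Dmix : mix_closed D.
  move=> a b r Da Db /andP[r0 r1].
  by apply: DD; apply: DZ => //; rewrite subr_gt0.
have [z [b [zp zD]]] := separate_point _ _ D p (ex_intro _ _ D0) Dmix Dclosed NDp.
exists z.
  apply: lt_le_trans zp _; apply: le_trans (zD _ D0) _.
  by rewrite /dot big1 // => t _; rewrite mulr0.
move=> a Da; rewrite leNgt; apply/negP => za.
(* Scaling [a] by this factor gives the product the value [-(|b| + 1)], which is below [b]. *)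
have k0 : 0 < (`|b| + 1) / - dot z a.
  by rewrite divr_gt0 ?oppr_gt0// ltr_wpDl.
have := zD _ (DZ _ _ k0 Da); rewrite dotZr invrN mulrN mulNr divfK ?lt_eqF//.
have := ler_norm (- b); rewrite normrN; lra.
Qed.

(** * Expected utilities and the relations they represent *)

Section Utilities.
Variables (R : realType) (S : finType) (K : nat).
Local Notation T := (S * 'I_K.+1)%type.
Implicit Types (v w z : T -> R) (X Y Z : lottery R S K).

Lemma lottery_ext X Y : (forall p, X p = Y p) -> X = Y.
Proof.
case: X Y => f f0 f1 [g g0 g1] /= /funext fg; subst g.
by congr Lottery; exact: Prop_irrelevance.
Qed.

Lemma exputilE v X : exputil v X = dot X v.
Proof. by rewrite /exputil /dot pair_bigA/=; apply: eq_bigr => -[]. Qed.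

Lemma exputil_sure v c : exputil v (sure R S c) = \sum_(s : S) v (s, c).
Proof.
apply: eq_bigr => s _; rewrite (bigD1 c)//= /sure_fun/= eqxx mul1r big1 ?addr0//.
by move=> i /negbTE ->; rewrite mul0r.
Qed.

Lemma exputil_sub v X Y : exputil v X - exputil v Y = dot v (fun p => X p - Y p).
Proof.
rewrite !exputilE /dot -sumrB; apply: eq_bigr => p _.
by rewrite mulrC [X in _ - X]mulrC mulrBr.
Qed.

Lemma exputil_mix v a (a01 : 0 < a < 1) X Z :
  exputil v (mix a01 X Z) = a * exputil v X + (1 - a) * exputil v Z.
Proof.
rewrite !exputilE /dot !mulr_sumr -big_split; apply: eq_bigr => p _.
by rewrite /= /mix_fun; ring.
Qed.

Lemma exputil_cvg v (X_ : nat -> lottery R S K) X :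
  (forall p, X_ n p @[n --> \oo] --> X p) ->
  exputil v (X_ n) @[n --> \oo] --> exputil v X.
Proof.
move=> XX; rewrite exputilE; under eq_cvg do rewrite exputilE.
by apply: cvg_sumr => p _; apply: cvgM; [exact: XX|exact: cvg_cst].
Qed.

Lemma exputil_cvgl (F : set_system (T -> R)) v X : Filter F ->
  (forall p, w p @[w --> F] --> v p) ->
  exputil w X @[w --> F] --> exputil v X.
Proof.
move=> FF vv; rewrite exputilE; under eq_cvg do rewrite exputilE.
by apply: cvg_sumr => p _; apply: cvgM; [exact: cvg_cst|exact: vv].
Qed.

Lemma exputil_comb v w (a b : R) X :
  exputil (fun p => a * v p + b * w p) X = a * exputil v X + b * exputil w X.
Proof.
rewrite !exputilE /dot !mulr_sumr -big_split; apply: eq_bigr => p _ /=; ring.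
Qed.

Lemma exputil_sure_worst v : (forall s, v (s, worst) = 0) ->
  exputil v (sure R S worst) = 0.
Proof. by move=> v0; rewrite exputil_sure big1. Qed.

Lemma Vplus_exputil v : Vplus v <->
  [/\ forall s, v (s, worst) = 0,
      forall c : 'I_K.+1, (2 <= c)%N -> 0 <= exputil v (sure R S c) <= 1
    & exputil v (sure R S best) = 1].
Proof.
split=> -[v0 vc v1]; split=> [//|c c2|]; rewrite ?exputil_sure//.
  exact: vc.
by have := vc c c2; rewrite exputil_sure.
by rewrite -exputil_sure.
Qed.

Definition rep_pref (V : set (T -> R)) X Y : Prop :=
  forall v, V v -> 0 <= exputil v X - exputil v Y.

(** Expected utility is affine and continuous in the lottery, which gives A1 to A3. The
    normalization in [Vplus] gives A4 and A5, a member of [V] witnessing the strictness in A5. *)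
Lemma rep_pref_axioms (V : set (T -> R)) : V !=set0 -> V `<=` @Vplus R S K ->
  axiomsA1_A5 (rep_pref V).
Proof.
move=> [v0 Vv0] VV; split.
- split=> [X Y Z XY YZ v Vv|X v Vv]; last by rewrite subrr.
  by have := XY v Vv; have := YZ v Vv; lra.
- move=> X Y Z a a01; split=> XY v Vv; have := XY v Vv; rewrite !exputil_mix;
    case/andP: (a01) => a0 a1.
    move=> h; rewrite (_ : _ - _ = a * (exputil v X - exputil v Y)); last by ring.
    by rewrite mulr_ge0// ltW.
  rewrite (_ : _ - _ = a * (exputil v X - exputil v Y)); last by ring.
  by rewrite pmulr_rge0.
- move=> X_ Y_ X Y /ptws_cvgP XX /ptws_cvgP YY XY v Vv.
  have cXY : exputil v (X_ n) - exputil v (Y_ n) @[n --> \oo] -->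
      exputil v X - exputil v Y by apply: cvgB; exact: exputil_cvg.
  by apply: cvgr_to_ge cXY _; apply: nearW => n; exact: XY.
- move=> c c1; split=> v /VV /Vplus_exputil[v_0 v_c v_1]; have /andP[c0 c1'] := v_c c c1.
    by rewrite v_1 subr_ge0.
  by rewrite exputil_sure_worst// subr0.
- split=> [v /VV /Vplus_exputil[v_0 _ v_1]|].
    by rewrite v_1 exputil_sure_worst// subr0.
  move=> /(_ _ Vv0); have /VV /Vplus_exputil[v_0 _ ->] := Vv0.
  by rewrite exputil_sure_worst// sub0r oppr_ge0 ler10.
Qed.

End Utilities.

(** * The closed convex cone of preference directions *)

Section PreferenceCone.
Variables (R : realType) (S : finType) (K : nat).
Local Notation T := (S * 'I_K.+1)%type.
Implicit Types (v w z : T -> R) (X Y Z : lottery R S K).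

Definition weight z : R := 1 + \sum_p `|z p|.

Lemma weight_gt0 z : 0 < weight z.
Proof. by rewrite ltr_pwDl// sumr_ge0. Qed.

Lemma norm_le_weight z p : `|z p| <= weight z.
Proof.
rewrite /weight (bigD1 p)//= addrCA lerDl addr_ge0// sumr_ge0//.
Qed.

(* Normalizing by a weight that is continuous and positive everywhere lets one
   formula turn every balanced z into a lottery depending continuously on z;
   this is what makes A3 yield closedness of the preference cone. *)
Definition perturb_fun z p : R := (1 + z p / weight z) / K.+1%:R.

Lemma perturb_ge0 z s c : 0 <= perturb_fun z (s, c).
Proof.
rewrite /perturb_fun divr_ge0// -lerBlDl sub0r ler_pdivlMr ?weight_gt0// mulN1r.
by rewrite lerNl (le_trans _ (norm_le_weight z (s, c)))// -normrN ler_norm.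
Qed.

(** Up to positive factors, these are exactly the differences of two lotteries. *)
Definition balanced z : Prop := forall s, \sum_(c < K.+1) z (s, c) = 0.

Lemma perturb_sum1 z : balanced z ->
  forall s, \sum_(c < K.+1) perturb_fun z (s, c) = 1.
Proof.
move=> z0 s; rewrite -mulr_suml big_split/= -mulr_suml z0 mul0r addr0.
by rewrite sumr_const card_ord divff// pnatr_eq0.
Qed.

Definition perturb z (z0 : balanced z) : lottery R S K :=
  Lottery (perturb_ge0 z) (perturb_sum1 z z0).

Lemma balanced0 : balanced (fun _ => 0).
Proof. by move=> s; rewrite big1. Qed.

Definition uniform_lottery : lottery R S K := perturb _ balanced0.

Lemma perturb_sub z (z0 : balanced z) p :
  perturb z z0 p - uniform_lottery p = (weight z * K.+1%:R)^-1 * z p.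
Proof.
rewrite /= /perturb_fun mul0r addr0 -mulrBl [1 + _]addrC addrK invfM.
by rewrite [RHS]mulrC mulrA.
Qed.

Lemma perturb_cvg (u : nat -> T -> R) z (u0 : forall n, balanced (u n))
    (z0 : balanced z) : (forall p, u n p @[n --> \oo] --> z p) ->
  forall p, perturb (u n) (u0 n) p @[n --> \oo] --> perturb z z0 p.
Proof.
move=> uz p; rewrite /= /perturb_fun; apply: cvgM; last exact: cvg_cst.
apply: cvgD; first exact: cvg_cst.
apply: cvgM; first exact: uz.
apply: cvgV; first by rewrite gt_eqF// weight_gt0.
apply: cvgD; first exact: cvg_cst.
by apply: cvg_sumr => q _; apply: cvg_norm.
Qed.

Lemma balanced_sub X Y (k : R) : balanced (fun p => k * (X p - Y p)).
Proof. by move=> s; rewrite -mulr_sumr sumrB !lottery_sum1 subrr mulr0. Qed.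

Lemma balanced_lim (u : nat -> T -> R) z : (forall n, balanced (u n)) ->
  (forall p, u n p @[n --> \oo] --> z p) -> balanced z.
Proof.
move=> u0 uz s.
have : \sum_(c < K.+1) u n (s, c) @[n --> \oo] --> \sum_(c < K.+1) z (s, c).
  by apply: cvg_sumr => c _; exact: uz.
under eq_cvg do rewrite u0.
by move=> /(cvg_lim (@Rhausdorff R)) <-; rewrite lim_cst//; exact: Rhausdorff.
Qed.

Variable pref : lottery R S K -> lottery R S K -> Prop.
Hypothesis pref_axioms : axiomsA1_A5 pref.

(* With a = 1 / (1 + k), the hypothesis says
   (1 - a) X + a Y' = a X' + (1 - a) Y, so that mixing X >= Y with Y' gives
   X' >= Y' mixed with Y. *)
Lemma pref_of_diff (k : R) X Y X' Y' : 0 < k -> pref X Y ->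
  (forall p, X' p - Y' p = k * (X p - Y p)) -> pref X' Y'.
Proof.
case: pref_axioms => _ mi _ _ _ k0 XY kXY.
have k1 : 0 < 1 + k by rewrite ltr_wpDl.
have a01 : 0 < (1 + k)^-1 < 1 by rewrite invr_gt0 k1 invf_lt1// ltrDl.
have b01 : 0 < k / (1 + k) < 1 by rewrite divr_gt0//= ltr_pdivrMr// mul1r; lra.
apply/(mi X' Y' Y _ a01); move/(mi X Y Y' _ b01): XY.
suff [-> ->] : mix b01 X Y' = mix a01 X' Y /\ mix b01 Y Y' = mix a01 Y' Y by [].
split; apply: lottery_ext => p; rewrite /= /mix_fun; last by field; lra.
by rewrite -[X' p](subrK (Y' p)) kXY; field; lra.
Qed.

Definition pref_cone : set (T -> R) := [set z | exists k X Y,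
  [/\ 0 < k, pref X Y & forall p, z p = k * (X p - Y p)]].

Lemma pref_coneP X Y : pref_cone (fun p => X p - Y p) <-> pref X Y.
Proof.
split=> [[k [X' [Y' [k0 XY kXY]]]]|XY]; first exact: pref_of_diff k0 XY kXY.
by exists 1, X, Y; split=> // p; rewrite mul1r.
Qed.

Lemma pref_cone_balanced z : pref_cone z -> balanced z.
Proof.
move=> [k [X [Y [_ _ zE]]]] s.
by under eq_bigr do rewrite zE; exact: balanced_sub.
Qed.

(** Membership in the cone becomes a single preference against a fixed lottery, the form in which A1
    and A3 can be applied. *)
Lemma pref_cone_perturb z (z0 : balanced z) :
  pref_cone z <-> pref (perturb z z0) uniform_lottery.
Proof.
have w0 : 0 < weight z * K.+1%:R by rewrite mulr_gt0 ?weight_gt0.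
split=> [[k [X [Y [k0 XY zE]]]]|zM].
  apply: (pref_of_diff ((weight z * K.+1%:R)^-1 * k) X Y) => // [|p].
    by rewrite mulr_gt0// invr_gt0.
  by rewrite perturb_sub zE mulrA.
exists (weight z * K.+1%:R), (perturb z z0), uniform_lottery; split=> // p.
by rewrite perturb_sub mulVKf// gt_eqF.
Qed.

Lemma pref_cone0 : pref_cone (fun _ => 0).
Proof.
apply/(pref_cone_perturb _ balanced0); case: pref_axioms => -[_ rf] _ _ _ _.
exact: rf.
Qed.

Lemma pref_coneZ k z : 0 < k -> pref_cone z -> pref_cone (fun p => k * z p).
Proof.
move=> k0 [l [X [Y [l0 XY zE]]]]; exists (k * l), X, Y; split=> // [|p].
  exact: mulr_gt0.
by rewrite zE mulrA.
Qed.

(** Mixing the two preferences with weights proportional to [k] and [l] adds the directions. A2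
    replaces one component at a time, and transitivity joins the two replacements. *)
Lemma pref_coneD z w :
  pref_cone z -> pref_cone w -> pref_cone (fun p => z p + w p).
Proof.
case: pref_axioms => -[tr _] mi _ _ _.
move=> [k [X [Y [k0 XY zE]]]] [l [X' [Y' [l0 XY' wE]]]].
have kl0 : 0 < k + l by exact: addr_gt0.
have a01 : 0 < k / (k + l) < 1 by rewrite divr_gt0//= ltr_pdivrMr// mul1r; lra.
have b01 : 0 < l / (k + l) < 1 by rewrite divr_gt0//= ltr_pdivrMr// mul1r; lra.
have mixC (U V : lottery R S K) : mix a01 U V = mix b01 V U.
  by apply: lottery_ext => p; rewrite /= /mix_fun; field; lra.
exists (k + l), (mix a01 X X'), (mix a01 Y Y'); split=> // [|p].
  apply: (tr _ (mix a01 Y X')); first exact: (mi X Y X' _ a01).1.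
  by rewrite !(mixC Y); exact: (mi X' Y' Y _ b01).1.
by rewrite zE wE /= /mix_fun; field; lra.
Qed.

Lemma pref_cone_closed : pw_seq_closed pref_cone.
Proof.
case: (pref_axioms) => _ _ ct _ _ u l uD ul.
have u0 n : balanced (u n) by exact: pref_cone_balanced.
have l0 : balanced l by exact: balanced_lim ul.
apply/(pref_cone_perturb _ l0).
apply: (ct (fun n => perturb (u n) (u0 n)) (fun _ => uniform_lottery)).
- by apply/ptws_cvgP => p; exact: perturb_cvg.
- by apply/ptws_cvgP => p; exact: cvg_cst.
- by move=> n; exact/(pref_cone_perturb _ (u0 n)).
Qed.

(** * Dual utilities and the representing set *)

(** Dual utilities before normalization: the total weight of the best consequence may still be 0. *)
Definition pref_dual w : Prop := (forall s, w (s, worst) = 0) /\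
  forall X Y, pref X Y -> exputil w Y <= exputil w X.

Lemma exists_dual X Y : ~ pref X Y ->
  exists2 w, pref_dual w & exputil w X < exputil w Y.
Proof.
move=> NXY; have ND : ~ pref_cone (fun p => X p - Y p) by move/pref_coneP.
have [z zXY zD] := separate_cone _ _ _ _ pref_cone0 pref_coneD pref_coneZ
  pref_cone_closed ND.
(* Subtracting a constant from each row makes the worst column vanish. It shifts all expected
   utilities by the same amount, as lottery rows sum to 1. *)
pose w (p : T) := z p - z (p.1, worst).
have wE X' : exputil w X' = exputil z X' - \sum_s z (s, worst).
  rewrite /exputil -sumrB; apply: eq_bigr => s _.
  under eq_bigr do rewrite mulrBr /=.
  by rewrite sumrB -mulr_suml lottery_sum1 mul1r.
exists w; last by rewrite !wE -subr_lt0 opprB addrA subrK exputil_sub.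
split=> [s|X' Y' XY']; first by rewrite /w subrr.
rewrite !wE -subr_ge0 opprB addrA subrK exputil_sub; apply: zD.
exact/pref_coneP.
Qed.

Definition dual_set : set (T -> R) :=
  [set v | Vplus v /\ forall X Y, pref X Y -> exputil v Y <= exputil v X].

(** A utility [w] violating the given preference may not be normalizable. Adding [e * w'], where
    [w'] separates best from worst, makes the total weight of best positive, and a small [e] keeps
    the violation. *)
Lemma exists_dual_set X Y : ~ pref X Y ->
  exists2 v, dual_set v & exputil v X < exputil v Y.
Proof.
move=> /exists_dual[w [w0 wP] wXY]; case: (pref_axioms) => _ _ _ bw [b_w w_b].
have [w' [w'0 w'P]] := exists_dual _ _ w_b; rewrite exputil_sure_worst// => w'b.
(* Chosen so that [e] times the difference for [w'] stays below the margin by which [w] ranks [Y]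
   over [X]. *)
pose e := (exputil w Y - exputil w X) / (`|exputil w' X - exputil w' Y| + 1).
have n0 : 0 < `|exputil w' X - exputil w' Y| + 1 by rewrite ltr_wpDl.
have e0 : 0 < e by rewrite divr_gt0// subr_gt0.
pose u := fun p => 1 * w p + e * w' p.
have u0 s : u (s, worst) = 0 by rewrite /u w0 w'0 !mulr0 addr0.
have uP X' Y' : pref X' Y' -> exputil u Y' <= exputil u X'.
  by move=> XY; rewrite !exputil_comb !mul1r lerD ?ler_pM2l ?wP ?w'P.
have uXY : exputil u X < exputil u Y.
  rewrite !exputil_comb !mul1r.
  suff : e * (exputil w' X - exputil w' Y) < exputil w Y - exputil w X.
    by rewrite mulrBr; lra.
  rewrite /e mulrAC ltr_pdivrMr// ltr_pM2l ?subr_gt0//.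
  by rewrite (le_lt_trans (ler_norm _))// ltrDl.
have ub : 0 < exputil u (sure R S best).
  rewrite exputil_comb mul1r; apply: ltr_wpDl; last exact: mulr_gt0.
  by have := wP _ _ b_w; rewrite exputil_sure_worst.
pose r := (exputil u (sure R S best))^-1; have r0 : 0 < r by rewrite invr_gt0.
(* The zero summand lets [exputil_comb] cover plain scaling. *)
have vE X' : exputil (fun p => r * u p + 0 * u p) X' = r * exputil u X'.
  by rewrite exputil_comb mul0r addr0.
exists (fun p => r * u p + 0 * u p); last by rewrite !vE ltr_pM2l.
split=> [|X' Y' XY]; last by rewrite !vE ler_pM2l// uP.
apply/Vplus_exputil; split=> [s|c c2|]; first by rewrite u0 !mulr0 addr0.
  have [bc cw] := bw c c2; rewrite vE; apply/andP; split.
    by apply: mulr_ge0; [exact: ltW|have := uP _ _ cw; rewrite exputil_sure_worst].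
  by rewrite mulrC ler_pdivrMr// mul1r uP.
by rewrite vE mulVf// gt_eqF.
Qed.

Lemma dual_set_rep : closed_convex_rep pref dual_set.
Proof.
split.
- case: (pref_axioms) => _ _ _ _ [_ /exists_dual_set[v Vv _]].
  by exists v.
(* A point of the closure is the limit of a proper filter [F] concentrated on [dual_set]. Each
   defining condition passes to the limit, equalities as pairs of inequalities. *)
- rewrite /closed closureEcvg => v [F PF [/ptws_cvgP Fv VF]].
  have FV : \forall w \near F, dual_set w by exact: VF.
  have FU X : exputil w X @[w --> F] --> exputil v X by exact: exputil_cvgl.
  have FVp : \forall w \near F, [/\ forall s, w (s, worst) = 0,
      forall c : 'I_K.+1, (2 <= c)%N -> 0 <= exputil w (sure R S c) <= 1
    & exputil w (sure R S best) = 1].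
    by apply: filterS FV => w [/Vplus_exputil].
  split; first (apply/Vplus_exputil; split=> [s|c c2|]).
  + apply/eqP; rewrite eq_le; apply/andP; split.
      by apply: cvgr_to_le (Fv _) _; apply: filterS FVp => w [->].
    by apply: cvgr_to_ge (Fv _) _; apply: filterS FVp => w [->].
  + apply/andP; split.
      by apply: cvgr_to_ge (FU _) _; apply: filterS FVp => w [_ /(_ c c2)/andP[]].
    by apply: cvgr_to_le (FU _) _; apply: filterS FVp => w [_ /(_ c c2)/andP[]].
  + apply/eqP; rewrite eq_le; apply/andP; split.
      by apply: cvgr_to_le (FU _) _; apply: filterS FVp => w [_ _ ->].
    by apply: cvgr_to_ge (FU _) _; apply: filterS FVp => w [_ _ ->].
  + move=> X Y XY; rewrite -subr_ge0.
    have FXY : exputil w X - exputil w Y @[w --> F] -->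
      exputil v X - exputil v Y by apply: cvgB; exact: FU.
    apply: cvgr_to_ge FXY _; apply: filterS FV => w [_ wP].
    by rewrite subr_ge0 wP.
- move=> v w t; rewrite !inE => -[/Vplus_exputil[v0 vc v1] vP].
  move=> [/Vplus_exputil[w0 wc w1] wP].
  have [t0 t1] : 0 <= t%:num /\ 0 <= 1 - t%:num by rewrite subr_ge0.
  have -> : conv t v w = (fun p => t%:num * v p + (1 - t%:num) * w p) by [].
  split; first (apply/Vplus_exputil; split=> [s|c c2|]).
  + by rewrite v0 w0 !mulr0 addr0.
  + rewrite exputil_comb; have /andP[? ?] := vc c c2; have /andP[? ?] := wc c c2.
    by apply/andP; split; nra.
  + by rewrite exputil_comb v1 w1; ring.
  + by move=> X Y XY; rewrite !exputil_comb lerD// ler_wpM2l ?vP ?wP.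
- by move=> v [].
- move=> X Y; split=> [XY v [_ vP]|XY]; first by rewrite subr_ge0 vP.
  apply: contrapT => /exists_dual_set[v Vv]; rewrite ltNge => /negP; apply.
  by rewrite -subr_ge0; exact: XY.
Qed.

End PreferenceCone.

(** * Uniqueness of the representing set *)

(* Strict separation of v from V gives an affine functional; its constant term
   is absorbed in the best column, where V+ prescribes total weight 1, and the
   worst column, where V+ vanishes, is free to balance the rows. *)
Lemma dual_set_subset (R : realType) (S : finType) (K : nat)
    (pref : lottery R S K -> lottery R S K -> Prop)
    (V : set (S * 'I_K.+1 -> R)) :
  closed_convex_rep pref V -> dual_set R S K pref `<=` V.
Proof.
move=> [V0 Vclosed Vconvex VV Vrep] v [vplus vP]; apply: contrapT => NVv.
have Vmix : mix_closed V.
  move=> a b r Va Vb /andP[r0 r1].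
  by have := Vconvex a b (Itv01 (ltW r0) (ltW r1)); rewrite !inE; exact.
have Vseq : pw_seq_closed V.
  move=> u l uV ul.
  have ul' : {ptws, u @ \oo --> l} by apply/ptws_cvgP => p; exact: ul.
  by apply: (@closed_cvg nat {ptws _ -> R} \oo _ u V Vclosed _ l ul'); exact: nearW.
have [y [b [yv yV]]] := separate_point _ _ V v V0 Vmix Vseq NVv.
pose y1 (p : S * 'I_K.+1) := y p - b * (p.2 == best)%:R.
pose z (p : S * 'I_K.+1) :=
  y1 p - (p.2 == worst)%:R * \sum_(c < K.+1) y1 (p.1, c).
have z0 : balanced R S K z.
  move=> s; have w1 : \sum_(c < K.+1) (c == worst)%:R = 1 :> R.
    by rewrite (bigD1 worst)//= big1 ?addr0// => c /negbTE ->.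
  by rewrite /z/= sumrB -mulr_suml w1 mul1r subrr.
have zE w : Vplus w -> dot z w = dot y w - b.
  move=> [w0 _ w1]; rewrite -[X in _ - X]mulr1 -w1 -exputil_sure exputilE /dot.
  rewrite mulr_sumr -sumrB; apply: eq_bigr => -[s c] _.
  rewrite /z /y1 /= /sure_fun/=; have [->|_] := eqVneq c worst.
    by rewrite w0 !mulr0 subrr.
  by rewrite mul0r subr0 mulrBl mulrA.
pose k := (weight R S K z * K.+1%:R)^-1.
have k0 : 0 < k by rewrite invr_gt0 mulr_gt0 ?weight_gt0.
have UE w : Vplus w -> exputil w (perturb R S K z z0) -
    exputil w (uniform_lottery R S K) = k * (dot y w - b).
  move=> Vw; rewrite -zE// exputil_sub -dotZl /dot.
  by apply: eq_bigr => p _; rewrite perturb_sub mulrC.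
(* The bound [b] holds on all of [V], so [V] declares this a preference. The dual utility [v] must
   then respect it, contradicting [yv]. *)
have /vP : pref (perturb R S K z z0) (uniform_lottery R S K).
  apply/Vrep => w Vw; rewrite UE; last exact: VV.
  by rewrite pmulr_rge0// subr_ge0 yV.
by rewrite -subr_ge0 UE// pmulr_rge0// subr_ge0 leNgt yv.
Qed.

(** * The equivalence and the description by a basis *)

Theorem theorem2 (R : realType) (S : finType) (K : nat)
    (hS : (0 < #|S|)%N) (hK : (1 <= K)%N)
    (pref : lottery R S K -> lottery R S K -> Prop) :
  (axiomsA1_A5 pref <->
   exists V : set (S * 'I_K.+1 -> R), closed_convex_rep pref V) /\
  (axiomsA1_A5 pref ->
   forall (I : Type) (X_ Y_ : I -> lottery R S K),
     is_basis pref X_ Y_ ->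
   forall V : set (S * 'I_K.+1 -> R), closed_convex_rep pref V ->
     V = [set v | Vplus v /\
                  forall i, exputil v (X_ i) >= exputil v (Y_ i)]).
Proof.
split.
  split=> [pref_axioms|[V [V0 _ _ VV Vrep]]].
    by exists (dual_set R S K pref); exact: dual_set_rep.
  have -> : pref = rep_pref R S K V.
    by apply/funext => X; apply/funext => Y; apply/propext; exact: Vrep.
  exact: rep_pref_axioms.
move=> _ I X_ Y_ [_ XY pref_min] V Vrep; have [V0 _ _ VV VP] := Vrep.
apply/seteqP; split=> [v Vv|v [vplus vXY]].
  by split=> [|i]; [exact: VV|rewrite -subr_ge0; exact: (VP _ _).1].
apply: (dual_set_subset R S K pref V Vrep); split=> // X Y pXY.
(* The relation represented by [W] contains the basis and satisfies the axioms, [W] being nonempty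
   thanks to [v]. Minimality of [pref] then makes every member of [W], hence [v], respect all of
   [pref]. *)
pose W := [set w | @Vplus R S K w /\ forall i, exputil w (Y_ i) <= exputil w (X_ i)].
have W_axioms : axiomsA1_A5 (rep_pref R S K W).
  by apply: rep_pref_axioms => [|w []//]; exists v.
rewrite -subr_ge0; apply: (pref_min _ W_axioms _ X Y pXY v (conj vplus vXY)).
by move=> i w [_ wXY]; rewrite subr_ge0.
Qed.
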